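(* Let $\epsilon>0$. Run the VMD algorithm (described in the context) with $$K=\left\lceil\log_2\left(\tfrac{1+\bar h}{(1-\gamma)\epsilon}\right)\right\rceil,\qquad T=\left\lceil\tfrac{4}{1-\gamma}\right\rceil,\qquad \eta_{k,t}=\tfrac{2^kD_0}{u_k}\quad (t=0,\dots,T-1,\ k=0,\dots,K-1),$$ where $u_k=\frac{1+\bar h}{2^k(1-\gamma)}$ and $D_0$ is a constant with $\|D^{\pi}_{\hat\pi_0}\|_\infty\le D_0$ for every policy $\pi$. Then the output policy $\hat\pi_K$ is $\epsilon$-optimal, i.e. $\|V^{\hat\pi_K}-V^*\|_\infty\le\epsilon$.
   Context: MDP. $(\mathbb S,\mathbb A,\mathbb P,c,\gamma)$ is a discounted Markov decision process with finite state space $\mathbb S$, finite action space $\mathbb A$, transition kernel $\mathbb P(s'|s,a)$, cost $c(s,a)\in[0,1]$, discount $\gamma\in(0,1)$. For $V\in\mathbb R^{|\mathbb S|}$, $\mathbb P_sV\in\mathbb R^{|\mathbb A|}$ has entries $(\mathbb P_sV)(a)=\sum_{s'}\mathbb P(s'|s,a)V(s')$. $\Delta_{\mathbb A}$ is the probability simplex over $\mathbb A$; a policy $\pi$ assigns $\pi(\cdot|s)\in\Delta_{\mathbb A}$ to each $s$. $h:\Delta_{\mathbb A}\to[0,\bar h]$ is a continuous convex regularizer. $V^\pi(s)=\mathbb E[\sum_{t\ge0}\gamma^t(c(s_t,a_t)+h(\pi(\cdot|s_t)))\mid s_0=s,\ a_t\sim\pi(\cdot|s_t),\ s_{t+1}\sim\mathbb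 P(\cdot|s_t,a_t)]$. $\pi^*$ is an optimal policy ($V^{\pi^*}\le V^\pi$ componentwise for all $\pi$; it exists) and $V^*=V^{\pi^*}$. Bregman divergence. $\omega:\Delta_{\mathbb A}\to\mathbb R$ is a continuously differentiable distance generating function, $1$-strongly convex with respect to a norm $\|\cdot\|$; $D(x_1,x_2)=\omega(x_2)-\omega(x_1)-\langle\nabla\omega(x_1),x_2-x_1\rangle$; for policies $\pi,\pi'$, $D^{\pi}_{\pi'}\in\mathbb R^{|\mathbb S|}$ has entries $D^{\pi}_{\pi'}(s)=D(\pi'(\cdot|s),\pi(\cdot|s))$. VMD algorithm. Input: positive integers $K,T$, positive stepsizes $\eta_{k,t}$ ($0\le k\le K-1$, $0\le t\le T-1$); $\hat\pi_0(\cdot|s)$ is the uniform distribution on $\mathbb A$ for all $s$; $\hat V_0=\frac{1+\bar h}{1-\gamma}\mathbf 1_{\mathbb S}$ ($\mathbf 1_{\mathbb S}$ the all-ones vector). For each epoch $k=0,\dots,K-1$: set $V_0=\hat V_k$, $\pi_0=\hat\pi_k$, $\eta_t=\eta_{k,t}$; for $t=0,\dots,T-1$ and all $s\in\mathbb S$, $$\pi_{t+1}(\cdot|s)=\arg\min_{\pi(\cdot|s)\in\Delta_{\mathbb A}}\{\eta_t[\langle c(s,\cdot)+\gamma\mathbb P_sV_t,\pi(\cdot|s)\rangle+h(\pi(\cdot|s))]+D^{\pi}_{\pi_t}(s)\},$$ $$V_{t+1}(s)=\langle c(s,\cdot)+\gamma\mathbb P_sV_t,\pi_{t+1}(\cdot|s)\rangle+h(\pi_{t+1}(\cdot|s));$$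 then set $\hat V_{k+1}=V_T$, $\hat\pi_{k+1}=\pi_T$. Output $\hat\pi_K,\hat V_K$. *)

(* Defs.v *)
From HB Require Import structures.
From mathcomp Require Import all_boot all_order all_algebra.
From mathcomp Require Import ring lra.
From mathcomp Require Import all_classical all_reals all_analysis.

Set Implicit Arguments.
Unset Strict Implicit.
Unset Printing Implicit Defensive.

Import Order.TTheory GRing.Theory Num.Theory.
Import numFieldNormedType.Exports.

Local Open Scope classical_set_scope.
Local Open Scope ring_scope.

Section vectors.
Context {R : realType} {T : finType}.
Implicit Types (f g : T -> R).

Definition dot f g : R := \sum_i f i * g i.

Definition sup_norm f : R := \big[Num.max/0]_i `|f i|.

Definition is_norm (N : (T -> R) -> R) : Prop :=
  [/\ forall f g, N (f + g) <= N f + N g,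
      forall (k : R) f, N (fun i => k * f i) = `|k| * N f
    & forall f, N f = 0 -> f = 0].

Definition simplex : set (T -> R) :=
  [set p | (forall i, 0 <= p i) /\ \sum_i p i = 1].

Definition argmin_on (D : set (T -> R)) (F : (T -> R) -> R) (x : T -> R) :
  Prop := D x /\ (forall y, D y -> F x <= F y).

Definition uniform : T -> R := fun=> #|T|%:R^-1.

End vectors.
Arguments simplex {R} T.
Arguments uniform {R} T.

Section bregman.
Context {R : realType} {A : finType}.
Implicit Types (h w : (A -> R) -> R) (dw : (A -> R) -> (A -> R)).

Definition continuous_on_simplex h : Prop :=
  {within (simplex A : set {ptws A -> R}), continuous h}.

Definition convex_on_simplex h : Prop :=
  convex_function (simplex A : set (A -> R^o)) h.

(* [w] need only be defined on the simplex, which has empty interior in [A -> R]: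
   differentiability is taken along the simplex, and the gradient [dw] is then
   determined up to the addition of constant vectors, to which [bregman] is
   insensitive on the simplex. *)
Definition C1_on_simplex w dw : Prop :=
  (forall x, simplex A x -> forall e : R, 0 < e ->
     \forall y \near within (simplex A) (nbhs (x : {ptws A -> R})),
       `|w y - w x - dot (dw x) (y - x)| <= e * sup_norm (y - x)) /\
  (forall a, continuous_on_simplex (fun x => dw x a)).

Definition strongly_convex_on_simplex (N : (A -> R) -> R) w : Prop :=
  forall x y (t : R), simplex A x -> simplex A y -> 0 <= t <= 1 ->
    w (fun a => t * x a + (1 - t) * y a)
      <= t * w x + (1 - t) * w y - t * (1 - t) / 2 * N (x - y) ^+ 2.

Definition bregman w dw (x1 x2 : A -> R) : R :=
  w x2 - w x1 - dot (dw x1) (x2 - x1).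

End bregman.

Section mdp.
Context {R : realType} {S A : finType}.

Record mdp := Mdp {
  trans : S -> A -> S -> R ;
  cost : S -> A -> R ;
  disc : R ;
  trans_simplex : forall s a, simplex S (trans s a) ;
  cost_itv : forall s a, 0 <= cost s a <= 1 ;
  disc_itv : 0 < disc < 1 }.

Definition is_policy (pi : S -> A -> R) : Prop := forall s, simplex A (pi s).

Implicit Types (M : mdp) (h : (A -> R) -> R) (pi : S -> A -> R).

(* [X t = (s_t, a_t)] is a trajectory of [pi] from [s0]: its finite-dimensional
   distributions are those of [s_0 = s0], [a_t ~ pi(.|s_t)],
   [s_(t+1) ~ P(.|s_t, a_t)]. *)
Definition is_trajectory M pi (s0 : S) d (Omega : measurableType d)
    (P : probability Omega R) (X : nat -> Omega -> S * A) : Prop :=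
  (forall t x, measurable [set o | X t o = x]) /\
  (forall n (x : nat -> S * A),
     P [set o | forall i, (i <= n)%N -> X i o = x i] =
     (((x 0).1 == s0)%:R * pi (x 0).1 (x 0).2 *
      \prod_(i < n) (trans M (x i).1 (x i).2 (x i.+1).1 *
                     pi (x i.+1).1 (x i.+1).2))%:E).

Definition discounted_cost M h pi (x : nat -> S * A) : R :=
  limn (series (fun t =>
    disc M ^+ t * (cost M (x t).1 (x t).2 + h (pi (x t).1)))).

Definition is_value M h pi (s : S) (v : R) : Prop :=
  exists (d : measure_display) (Omega : measurableType d)
         (P : probability Omega R) (X : nat -> Omega -> S * A),
    is_trajectory M pi s P X /\
    v%:E = ('E_P[fun o => discounted_cost M h pi (X ^~ o)])%E.

(* The law of the trajectory determines the expectation, and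
   [trajectory_exists] below shows that a trajectory exists, so that the default
   value of [xget] is irrelevant for policies. *)
Definition value M h pi (s : S) : R := xget 0 [set v | is_value M h pi s v].

Definition is_optimal M h pi : Prop :=
  is_policy pi /\
  (forall pi', is_policy pi' -> forall s, value M h pi s <= value M h pi' s).

Definition qvec M (V : S -> R) (s : S) : A -> R :=
  fun a => cost M s a + disc M * \sum_s' trans M s a s' * V s'.

(* [pi k t] and [V k t] are the iterates [pi_t] and [V_t] of epoch [k]; the
   argmin is unique because the objective is strongly convex. *)
Record vmd_run M h w dw (hbar : R) (K T : nat) (eta : nat -> nat -> R)
    (hatpi : nat -> S -> A -> R) (hatV : nat -> S -> R)
    (pi : nat -> nat -> S -> A -> R) (V : nat -> nat -> S -> R) : Prop :=
  VmdRun {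
    vmd_pi0 : forall s, hatpi 0 s = uniform A ;
    vmd_V0 : forall s, hatV 0 s = (1 + hbar) / (1 - disc M) ;
    vmd_epoch_pi0 : forall k, (k < K)%N -> pi k 0 = hatpi k ;
    vmd_epoch_V0 : forall k, (k < K)%N -> V k 0 = hatV k ;
    vmd_policy_step : forall k t s, (k < K)%N -> (t < T)%N ->
      argmin_on (simplex A)
        (fun p => eta k t * (dot (qvec M (V k t) s) p + h p)
                  + bregman w dw (pi k t s) p)
        (pi k t.+1 s) ;
    vmd_value_step : forall k t s, (k < K)%N -> (t < T)%N ->
      V k t.+1 s = dot (qvec M (V k t) s) (pi k t.+1 s) + h (pi k t.+1 s) ;
    vmd_epoch_pi : forall k, (k < K)%N -> hatpi k.+1 = pi k T ;
    vmd_epoch_V : forall k, (k < K)%N -> hatV k.+1 = V k T }.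

End mdp.
Arguments mdp : clear implicits.

(* A Markov chain on a finite type is realized on [0, 1[ under the uniform
   measure by inverse-transform sampling with rescaling: every cylinder event is
   then an interval. *)
Section markov_chain_exists.
Context {R : realType} {X : finType} (x0 : X) (K : X -> X -> R).
Hypothesis K_simplex : forall x, simplex X (K x).
Implicit Types (mu : X -> R).

Let cum mu (x : X) : R := \sum_(y | (enum_rank y < enum_rank x)%N) mu y.
Let cell mu (u : R) (x : X) := cum mu x <= u < cum mu x + mu x.
Let sample mu (u : R) : X := odflt x0 [pick x | cell mu u x].

Let cumS mu x : cum mu x + mu x =
  \sum_(y | (enum_rank y <= enum_rank x)%N) mu y.
Proof.
rewrite [RHS](bigD1 x)//= addrC; congr (_ + _); apply: eq_bigl => y.
by rewrite ltn_neqAle andbC -(inj_eq (@enum_rank_inj X)).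
Qed.

Let cum_ge0 mu x : simplex X mu -> 0 <= cum mu x.
Proof. by move=> [mu0 _]; exact: sumr_ge0. Qed.

Let ler_sum_sub (mu : X -> R) (P Q : pred X) :
  (forall x, 0 <= mu x) -> (forall x, P x -> Q x) ->
  \sum_(x | P x) mu x <= \sum_(x | Q x) mu x.
Proof.
move=> mu0 PQ; rewrite big_mkcond [leRHS]big_mkcond; apply: ler_sum => x _.
by case: ifPn => [/PQ ->//|_]; case: ifP.
Qed.

Let cum_le1 mu x : simplex X mu -> cum mu x + mu x <= 1.
Proof. by move=> [mu0 mu1]; rewrite cumS -mu1; exact: ler_sum_sub. Qed.

Let cell_uniq mu u x y : simplex X mu -> cell mu u x -> cell mu u y -> x = y.
Proof.
move=> [mu0 _] /andP[xu ux] /andP[yu uy].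
case: (ssrnat.ltngtP (enum_rank x) (enum_rank y)) => [xy|yx|/val_inj/enum_rank_inj//].
- have : cum mu x + mu x <= cum mu y.
    by rewrite cumS; apply: ler_sum_sub => // z /leq_ltn_trans; exact.
  by move=> ?; exfalso; lra.
- have : cum mu y + mu y <= cum mu x.
    by rewrite cumS; apply: ler_sum_sub => // z /leq_ltn_trans; exact.
  by move=> ?; exfalso; lra.
Qed.

Let cell_ex mu u : simplex X mu -> 0 <= u < 1 -> exists x, cell mu u x.
Proof.
move=> [mu0 mu1] /andP[u0 u1]; apply: contrapT => nex.
suff /(_ #|X| (leqnn _)) : forall n, (n <= #|X|)%N ->
    \sum_(y | (enum_rank y < n)%N) mu y <= u.
  rewrite (eq_bigl xpredT) ?mu1; first by lra.
  by move=> y; rewrite ltn_ord.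
elim=> [_|n IH nX]; first by rewrite big_pred0.
rewrite leNgt; apply/negP => un; apply: nex; exists (enum_val (Ordinal nX)).
by rewrite /cell cumS /cum !enum_valK/= IH ?un// ltnW.
Qed.

Let sampleP mu u x : simplex X mu -> 0 <= u < 1 ->
  (sample mu u = x) <-> cell mu u x.
Proof.
move=> mus u01; have [y yP] := cell_ex mus u01; rewrite /sample.
case: pickP => [z zP|/(_ y)]; last by rewrite yP.
by split=> [<-//|]; exact: cell_uniq.
Qed.

Fixpoint chain mu (n : nat) (u : R) : X :=
  if n is n'.+1 then
    chain (K (sample mu u)) n' ((u - cum mu (sample mu u)) / mu (sample mu u))
  else sample mu u.

Let cyl mu n (w : nat -> X) : R :=
  mu (w 0) * \prod_(i < n) K (w i) (w i.+1).

Let cyl_ge0 mu n w : simplex X mu -> 0 <= cyl mu n w.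
Proof.
move=> [mu0 _]; rewrite mulr_ge0//; apply: prodr_ge0 => i _.
by have [] := K_simplex (w i).
Qed.

Let chain_itv n mu (w : nat -> X) : simplex X mu ->
  exists2 a : R, 0 <= a /\ a + cyl mu n w <= 1 & forall u, 0 <= u < 1 ->
    (forall i, (i <= n)%N -> chain mu i u = w i) <-> a <= u < a + cyl mu n w.
Proof.
elim: n mu w => [|n IH] mu w mus.
  exists (cum mu (w 0)); rewrite /cyl big_ord0 mulr1.
    by split; [exact: cum_ge0|exact: cum_le1].
  move=> u u01; split=> [H|uw [|//] _].
    by apply/(sampleP _ mus u01); exact: (H 0).
  exact/(sampleP _ mus u01).
have [a [a0 a1] aP] := IH (K (w 0)) (w \o S) (K_simplex _).
have cylE : cyl mu n.+1 w = mu (w 0) * cyl (K (w 0)) n (w \o S).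
  by rewrite /cyl big_ord_recl.
set p := cyl _ _ _ in a1 aP cylE.
have p0 : 0 <= p by exact: cyl_ge0.
have muge0 := mus.1 (w 0).
have c0 := cum_ge0 (w 0) mus; have c1 := cum_le1 (w 0) mus.
exists (cum mu (w 0) + mu (w 0) * a).
  split; first by rewrite addr_ge0// mulr_ge0.
  by rewrite cylE -addrA -mulrDr (le_trans _ c1)// lerD2l ler_piMr.
move=> u u01; rewrite cylE -addrA -mulrDr.
have chainS : (forall i, (i <= n.+1)%N -> chain mu i u = w i) <->
    cell mu u (w 0) /\ forall i, (i <= n)%N ->
      chain (K (w 0)) i ((u - cum mu (w 0)) / mu (w 0)) = w i.+1.
  split=> [H|[/(sampleP _ mus u01) su H] [_|i ni]] //=.
    have /= su := H 0 isT; split; first exact/(sampleP _ mus u01).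
    by move=> i ni; have := H i.+1 ni; rewrite /= su.
  by rewrite su H.
rewrite chainS; move: muge0; rewrite le_eqVlt => /predU1P[mu0|mu0].
  rewrite /cell -mu0 addr0 !mul0r !addr0.
  split=> [[]|]; lra.
set v := (u - _) / _.
have uE : u = cum mu (w 0) + mu (w 0) * v.
  by rewrite /v mulrC divfK ?gt_eqF//; ring.
have cellE : cell mu u (w 0) = (0 <= v < 1).
  rewrite /cell uE lerDl ltrD2l pmulr_rge0//.
  by rewrite -[X in _ < X]mulr1 ltr_pM2l.
have itvE : (cum mu (w 0) + mu (w 0) * a <= u <
    cum mu (w 0) + mu (w 0) * (a + p)) = (a <= v < a + p).
  by rewrite uE lerD2l ltrD2l ler_pM2l// ltr_pM2l.
rewrite cellE itvE; split=> [[v01 /(aP _ v01)//]|vap].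
have v01 : 0 <= v < 1 by lra.
by split=> //; exact/aP.
Qed.

Let P : probability _ R := uniform_prob (@ltr01 R).

Let P_itv (a b : R) : 0 <= a -> a <= b -> b <= 1 -> P `[a, b[%classic = (b - a)%:E.
Proof.
move=> a0 ab b1.
have mI : measurable (`[a, b[%classic : set (measurableTypeR R)) by [].
have -> : P `[a, b[%classic = (\int[P]_x (\1_(`[a, b[%classic : set R) x)%:E)%E.
  by rewrite integral_indic// setIT.
rewrite integral_uniform//=; last first.
  exact/measurable_realfun.measurable_EFinP/measurable_realfun.measurable_indic.
rewrite subr0 invr1 mul1e integral_indic//= setIidl.
  have := @lebesgue_measure_itv R `[a, b[%R; rewrite /= lte_fin => ->.
  by move: ab; rewrite le_eqVlt => /predU1P[->|->//]; rewrite ltxx subrr.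
move=> x /=; rewrite !in_itv/= => /andP[ax xb]; apply/andP; split; lra.
Qed.

Let Pout : P (~` `[0, 1[%classic) = 0%E.
Proof.
by rewrite probability_setC// P_itv// subr0 subee.
Qed.

Let chain01 mu (n : nat) (u : R) : X := if 0 <= u < 1 then chain mu n u else x0.

Let cylinder01 mu n w : simplex X mu -> exists2 I : set R,
  measurable (I : set (measurableTypeR R)) /\ P I = (cyl mu n w)%:E &
  [set u | forall i, (i <= n)%N -> chain01 mu i u = w i] = I \/
  [set u | forall i, (i <= n)%N -> chain01 mu i u = w i] = I `|` ~` `[0, 1[%classic.
Proof.
move=> mus; have [a [a0 a1] aP] := chain_itv n w mus.
have p0 := cyl_ge0 n w mus.
exists `[a, a + cyl mu n w[%classic.
  by split=> //; rewrite P_itv ?lerDl// addrAC subrr add0r.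
have inE u : 0 <= u < 1 ->
    (forall i, (i <= n)%N -> chain01 mu i u = w i) <-> a <= u < a + cyl mu n w.
  by move=> u01; rewrite -(aP _ u01) /chain01 u01.
have outE u : (0 <= u < 1) = false ->
    (forall i, (i <= n)%N -> chain01 mu i u = w i) <->
    (forall i, (i <= n)%N -> x0 = w i).
  by move=> u01; rewrite /chain01 u01.
have [wx|wx] := pselect (forall i, (i <= n)%N -> x0 = w i); [right|left].
- apply/seteqP; split=> u /=; case u01: (0 <= u < 1).
  + by move/(inE _ u01) => uI; left; rewrite /= in_itv.
  + by move=> _; right; rewrite in_itv/= u01.
  + by case; rewrite in_itv/= ?u01// => uI; exact/inE.
  + by move=> _; exact/outE.
- apply/seteqP; split=> u /=; rewrite in_itv/=; case u01: (0 <= u < 1).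
  + by move/(inE _ u01).
  + by move/(outE _ u01).
  + by move=> uI; exact/inE.
  + by move: u01 => /negP u01 uI; exfalso; apply: u01; lra.
Qed.

Let cylinder_measurable mu n w : simplex X mu ->
  measurable ([set u | forall i, (i <= n)%N -> chain01 mu i u = w i]
    : set (measurableTypeR R)).
Proof.
move=> mus; have [I [mI _] [->//|->]] := cylinder01 n w mus.
by apply: measurableU => //; exact: measurableC.
Qed.

Lemma markov_chain_exists mu : simplex X mu ->
  exists (d : measure_display) (Omega : measurableType d)
    (P : probability Omega R) (Y : nat -> Omega -> X),
    (forall t x, measurable [set o | Y t o = x]) /\
    (forall n (w : nat -> X),
      P [set o | forall i, (i <= n)%N -> Y i o = w i] =
      (mu (w 0) * \prod_(i < n) K (w i) (w i.+1))%:E).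
Proof.
move=> mus; exists _, _, P, (chain01 mu); split.
  move=> t x.
  have -> : [set u | chain01 mu t u = x] =
      \bigcup_(f in [set f : {ffun 'I_t.+1 -> X} | f ord_max = x])
        [set u | forall i, (i <= t)%N -> chain01 mu i u = f (inord i)].
    apply/seteqP; split=> [u /= ux|u [f /= <- fu]]; last first.
      by rewrite /= fu//; congr (f _); apply: val_inj; rewrite /= inordK.
    exists [ffun i : 'I_t.+1 => chain01 mu i u]; rewrite /= ?ffunE//.
    by move=> i it; rewrite ffunE inordK.
  apply: fin_bigcup_measurable; first exact: finite_finset.
  by move=> f _; exact: (@cylinder_measurable _ _ (fun i => f (inord i))).
move=> n w; have [I [mI PI] [->//|->]] := cylinder01 n w mus.
have mO : measurable (~` `[0%R, 1%R[%classic : set (measurableTypeR R)).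
  exact: measurableC.
rewrite -[RHS]PI; apply/eqP; rewrite eq_le; apply/andP; split.
  by rewrite (le_trans (measureU2 _ mI mO))//= Pout adde0.
apply: le_measure; rewrite ?inE//; first exact: measurableU.
Qed.

End markov_chain_exists.

Lemma trajectory_exists {R : realType} {S A : finType} (M : mdp R S A)
    (pi : S -> A -> R) (s : S) : is_policy pi ->
  exists (d : measure_display) (Omega : measurableType d)
    (P : probability Omega R) (X : nat -> Omega -> S * A),
    is_trajectory M pi s P X.
Proof.
move=> pis.
have [a0 _] : exists a0 : A, True.
  apply: contrapT => nA; have [_] := pis s; rewrite big_pred0.
    by move/esym/eqP; rewrite oner_eq0.
  by move=> a; exfalso; apply: nA; exists a.
pose mu (x : S * A) : R := (x.1 == s)%:R * pi x.1 x.2.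
pose K (x y : S * A) : R := trans M x.1 x.2 y.1 * pi y.1 y.2.
have Ks x : simplex (S * A)%type (K x).
  have [t0 t1] := trans_simplex M x.1 x.2.
  split=> [y|]; first by rewrite mulr_ge0//; have [] := pis y.1.
  rewrite -(pair_bigA _ (fun i j => K x (i, j)))/= -[RHS]t1.
  apply: eq_bigr => i _; rewrite /K/= -big_distrr/=.
  by have [_ ->] := pis i; rewrite mulr1.
have mus : simplex (S * A)%type mu.
  split=> [y|]; first by rewrite mulr_ge0//; have [] := pis y.1.
  rewrite -(pair_bigA _ (fun i j => mu (i, j)))/= (bigD1 s)//=.
  rewrite [X in _ + X]big1 ?addr0; last first.
    by move=> i /negbTE is_; rewrite big1// => j _; rewrite /mu/= is_ mul0r.
  rewrite -[RHS](pis s).2; apply: eq_bigr => j _.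
  by rewrite /mu/= eqxx mul1r.
exact: (markov_chain_exists (s, a0) Ks mus).
Qed.

(* Main.v *)
Require Import Defs.
From mathcomp Require Import all_boot all_order all_algebra.
From mathcomp Require Import all_classical all_reals all_analysis.
From mathcomp Require Import measurable_realfun.
From mathcomp Require Import ring lra.
Import Order.TTheory GRing.Theory Num.Theory.
Import numFieldNormedType.Exports.
Local Open Scope classical_set_scope.
Local Open Scope ring_scope.

Set Implicit Arguments.
Unset Strict Implicit.
Unset Printing Implicit Defensive.

(** Why the theorem holds.  Write [gamma] for the discount, [D] for the Bregman
    divergence, [Pstar] for the state kernel of the optimal policy [pistar] and
    [Vstar] for its value.

    The value of a policy, an expectation over trajectories, is the unique fixed
    point of its Bellman operator ([value_bellman]): the marginal laws of a
    trajectory satisfy the Chapman-Kolmogorov recursion, along which the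
    fixed-point equation telescopes. By the minimum principle for
    [I - gamma P], any supersolution of the Bellman equation of a policy
    dominates its value ([value_le_supersolution]).

    The iterates [V_t] are supersolutions for the current policy [pi_t] and
    decrease ([epoch_supersolution], [epoch_descent]); hence
    [Vstar <= V^(pi_t) <= V_t], and it suffices to bound the gap
    [e_t = V_t - Vstar]. The three-point inequality for the minimizer
    ([mirror_step_le]), tested against [pistar], gives
      [e_(t+1) <= gamma Pstar e_t + (D_t - D_(t+1)) / eta]
    componentwise, where [D_t] is the divergence from [pi_t] to [pistar].
    Because [Pstar] mixes the states, the divergences cannot be controlled state
    by state. Instead the inequality is summed over the epoch and multiplied by
    the nonnegative matrix [G = (I - gamma Pstar)^-1], whose rows sum to
    [1 / (1 - gamma)] ([discounted_resolvent]). With the potential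
    [Phi = (1 - gamma) G D], monotonicity of [e_t] and
    [T >= 4 / (1 - gamma)], this yields ([epoch_gap])
      [4 e_T <= u_k + (Phi_k - Phi_(k+1)) / eta_k].
    As [e_T] and [Phi] are nonnegative and [eta_k = 2^k D0 / u_k], induction on
    the epochs gives [Phi_k <= 2^k D0] and [e <= u_k] at the start of epoch [k]
    ([vmd_gap]). The choice of [K] makes [u_K <= eps].

    If [D0 = 0] the step sizes vanish, but then strong convexity forces the
    simplex to be a singleton ([simplex_singleton]) and the run is unchanged by
    replacing [D0] with [1]. *)

(** * Vectors and the discounted resolvent of a stochastic kernel *)

Section dot_theory.
Context {R : realType} {T : finType}.
Implicit Types (f g p : T -> R).

Lemma dotDr f g p : dot p (f + g) = dot p f + dot p g.
Proof. by rewrite -big_split; apply: eq_bigr => i _; exact: mulrDr. Qed.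

Lemma dotBr f g p : dot p (f - g) = dot p f - dot p g.
Proof. by rewrite -sumrB; apply: eq_bigr => i _; exact: mulrBr. Qed.

Lemma dotZr f (k : R) p : dot p (fun i => k * f i) = k * dot p f.
Proof. by rewrite big_distrr; apply: eq_bigr => i _; rewrite mulrCA. Qed.

Lemma dot_sumr n (F : 'I_n -> T -> R) p :
  dot p (fun i => \sum_j F j i) = \sum_j dot p (F j).
Proof.
by rewrite [RHS]exchange_big; apply: eq_bigr => i _; rewrite big_distrr.
Qed.

Lemma ler_dotr f g p : (forall i, 0 <= p i) -> (forall i, f i <= g i) ->
  dot p f <= dot p g.
Proof. by move=> p0 fg; apply: ler_sum => i _; exact: ler_wpM2l. Qed.

Lemma dot_cst (c : R) p : dot p (fun=> c) = (\sum_i p i) * c.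
Proof. by rewrite big_distrl. Qed.

Lemma simplex_dot_cst (c : R) p : simplex T p -> dot p (fun=> c) = c.
Proof. by move=> [_ p1]; rewrite dot_cst p1 mul1r. Qed.

Lemma simplex_dot_le (c : R) f p : simplex T p -> (forall i, f i <= c) ->
  dot p f <= c.
Proof.
move=> ps fc; rewrite -[leRHS](simplex_dot_cst c ps).
by apply: ler_dotr => //; exact: ps.1.
Qed.

Lemma ler_sup_norm f i : `|f i| <= sup_norm f.
Proof. exact: (le_bigmax _ (fun i => `|f i|)). Qed.

Lemma sup_norm_le f (c : R) : 0 <= c -> (forall i, `|f i| <= c) ->
  sup_norm f <= c.
Proof. by move=> c0 fc; apply: bigmax_le. Qed.

Lemma simplex_inhabited p : simplex T p -> exists i : T, True.
Proof.
move=> [_]; have [i _ _|T0] := pickP (xpredT : pred T); first by exists i.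
by rewrite big_pred0// => /esym/eqP; rewrite oner_eq0.
Qed.

Lemma uniform_simplex (i0 : T) : simplex T (@uniform R T).
Proof.
split=> [i|]; first by rewrite invr_ge0.
rewrite sumr_const -[LHS]mulr_natr; apply: mulVf.
by rewrite pnatr_eq0 -lt0n; apply/card_gt0P; exists i0.
Qed.

End dot_theory.

Section resolvent.
Context {R : realType} {S : finType} (P : S -> S -> R) (g : R).
Hypotheses (P_simplex : forall s, simplex S (P s)) (g_itv : 0 <= g < 1).
Implicit Types f : S -> R.

(** Minimum principle for the operator [I - g P]. *)
Lemma discounted_min_principle f :
  (forall s, g * dot (P s) f <= f s) -> forall s, 0 <= f s.
Proof.
move=> fP s1; case/andP: g_itv => g0 g1.
pose s0 := [arg min_(s < s1) f s]%O.
have s0min s : f s0 <= f s.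
  by rewrite /s0; case: arg_minP => // i _ /(_ s isT).
apply: le_trans (s0min s1); have := fP s0.
have : f s0 <= dot (P s0) f.
  rewrite -[leLHS](simplex_dot_cst (f s0) (P_simplex s0)).
  by apply: ler_dotr => //; exact: (P_simplex s0).1.
move=> /(ler_wpM2l g0) h1 h2; have := le_trans h1 h2.
by rewrite -subr_ge0 -[X in X - _]mul1r -mulrBl pmulr_rge0// subr_gt0.
Qed.

(** [I - g P] is injective by the minimum principle, hence invertible, and its
    inverse [G] is nonnegative by the same principle; on constant functions
    [I - g P] is multiplication by [1 - g]. *)
Lemma discounted_resolvent : exists G : S -> S -> R,
  [/\ forall s s', 0 <= G s s',
      forall s, \sum_s' G s s' = (1 - g)^-1,
      forall f s, dot (G s) (fun s' => f s' - g * dot (P s') f) = f s &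
      forall f s, dot (G s) f - g * dot (P s) (fun s' => dot (G s') f) = f s].
Proof.
case/andP: (g_itv) => g0 g1.
pose L : 'M[R]_#|S| := \matrix_(i, j)
  ((i == j)%:R - g * P (enum_val i) (enum_val j)).
pose vec f : 'cV[R]_#|S| := \col_i f (enum_val i).
have reindexE f : \sum_(j < #|S|) f (enum_val j) = \sum_s f s.
  by rewrite [RHS](reindex _ (onW_bij _ (@enum_val_bij S))).
have LE f i : (L *m vec f) i ord0 =
    f (enum_val i) - g * dot (P (enum_val i)) f.
  rewrite mxE; under eq_bigr do rewrite !mxE mulrBl.
  rewrite sumrB; congr (_ - _).
    rewrite (bigD1 i)//= eqxx mul1r big1 ?addr0// => j /negbTE.
    by rewrite eq_sym => ->; rewrite mul0r.
  rewrite /dot big_distrr/= -[RHS]reindexE.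
  by apply: eq_bigr => j _; rewrite mulrA.
have vecK (v : 'cV[R]_#|S|) : vec (fun s => v (enum_rank s) ord0) = v.
  by apply/colP => i; rewrite mxE enum_valK.
have Lu : L \in unitmx.
  rewrite -unitmx_tr -row_free_unit -kermx_eq0; apply/eqP/row_matrixP => i.
  rewrite row0; set v := row i _.
  have vL : v *m L^T = 0 by apply/sub_kermxP; exact: row_sub.
  have {vL} : L *m v^T = 0 by rewrite -[L]trmxK -trmx_mul vL trmx0.
  set f := fun s => v^T (enum_rank s) ord0; rewrite -(vecK v^T) => Lf.
  have fE s : f s = g * dot (P s) f.
    apply/eqP; rewrite -subr_eq0; move/colP: Lf => /(_ (enum_rank s)).
    by rewrite LE enum_rankK [RHS]mxE => ->.
  have f_ge0 s : 0 <= f s.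
    by apply: discounted_min_principle => {}s; rewrite -fE.
  have f_le0 s : 0 <= - f s.
    apply: (discounted_min_principle (f := fun s => - f s)) => {}s.
    rewrite [in leRHS]fE -mulrN ler_wpM2l// /dot -sumrN.
    by apply: ler_sum => j _; rewrite mulrN.
  apply/trmx_inj; rewrite trmx0 -(vecK v^T); apply/colP => j; rewrite mxE [RHS]mxE.
  by apply/eqP; rewrite eq_le; apply/andP; split; [rewrite -oppr_ge0; exact: f_le0|exact: f_ge0].
pose G s s' := invmx L (enum_rank s) (enum_rank s').
have GE f s : dot (G s) f = (invmx L *m vec f) (enum_rank s) ord0.
  rewrite mxE /dot -[LHS]reindexE; apply: eq_bigr => j _.
  by rewrite /G mxE enum_valK.
have GL f s : dot (G s) (fun s' => f s' - g * dot (P s') f) = f s.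
  rewrite GE; have -> : vec (fun s' => f s' - g * dot (P s') f) = L *m vec f.
    by apply/colP => i; rewrite LE mxE.
  by rewrite mulKmx// mxE enum_rankK.
have LG f s : dot (G s) f - g * dot (P s) (fun s' => dot (G s') f) = f s.
  have := LE (fun s' => dot (G s') f) (enum_rank s); rewrite enum_rankK => <-.
  have -> : vec (fun s' => dot (G s') f) = invmx L *m vec f.
    by apply/colP => i; rewrite mxE GE enum_valK.
  by rewrite mulKVmx// mxE enum_rankK.
exists G; split=> // [s s'|s].
- have -> : G s s' = dot (G s) (fun t => (t == s')%:R).
    rewrite /dot (bigD1 s')//= eqxx mulr1 big1 ?addr0// => t /negbTE ->.
    by rewrite mulr0.
  apply: (discounted_min_principle (f := fun s => dot (G s) _)) => {}s.
  by rewrite -subr_ge0 LG.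
- have := GL (fun=> (1 - g)^-1) s.
  have -> : (fun s' => (1 - g)^-1 - g * dot (P s') (fun=> (1 - g)^-1)) =
      (fun=> 1).
    apply/funext => s'; rewrite (simplex_dot_cst _ (P_simplex s')).
    by rewrite -[X in X - _]mul1r -mulrBl divff// subr_eq0 gt_eqF.
  by rewrite dot_cst mulr1.
Qed.

End resolvent.

(** * Bregman divergences and the mirror descent step *)

Section mirror_step.
Context {R : realType} {A : finType}.
Implicit Types (x y p : A -> R).

(** The point at fraction [t] of the segment from [x] to [y]. *)
Definition segment x y (t : R) : A -> R := fun a => t * y a + (1 - t) * x a.

Lemma segment_simplex x y t : simplex A x -> simplex A y -> 0 <= t <= 1 ->
  simplex A (segment x y t).
Proof.
move=> [x0 x1] [y0 y1] /andP[t0 t1]; split=> [a|].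
  by rewrite addr_ge0// mulr_ge0// subr_ge0.
by rewrite big_split/= -!big_distrr/= x1 y1 !mulr1 addrC subrK.
Qed.

Lemma segmentB x y t : segment x y t - x = (fun a => t * (y - x) a).
Proof. by apply/funext => a; rewrite /segment !fctE; ring. Qed.

Lemma cvg_segment x y :
  segment x y t @[t --> (0 : R)^'+] --> (x : {ptws A -> R}).
Proof.
apply/cvg_sup => a W [B [[U oU <-] Ux] BW].
have Uxa : nbhs (x a) U by apply: open_nbhs_nbhs; split.
have : segment x y t a @[t --> (0 : R)^'+] --> x a.
  have -> : x a = 0 * y a + (1 - 0) * x a by ring.
  apply: cvg_at_right_filter; apply: cvgD; apply: cvgMl.
    exact: cvg_id.
  by apply: cvgB; [exact: cvg_cst|exact: cvg_id].
move=> /(_ _ Uxa) segU; apply: (@filterS _ ((0 : R)^'+) _ _ _ _ segU) => t.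
exact: BW.
Qed.

Lemma convex_on_simplexP (h : (A -> R) -> R) x y t : convex_on_simplex h ->
  simplex A x -> simplex A y -> 0 <= t <= 1 ->
  h (segment x y t) <= t * h y + (1 - t) * h x.
Proof.
move=> hc sx sy t01; pose t' := Itv01 (proj1 (andP t01)) (proj2 (andP t01)).
have /(_ y x) := hc t'; rewrite !inE => /(_ sy sx).
by [].
Qed.

Section dgf.
Context (w : (A -> R) -> R) (dw : (A -> R) -> (A -> R)).
Hypothesis w_C1 : C1_on_simplex w dw.

(** First order expansion of [w] along segments of the simplex, at some
    arbitrarily small parameter. *)
Lemma segment_expansion x y (e : R) : simplex A x -> simplex A y -> 0 < e ->
  exists t : R, [/\ 0 < t, t < e, t < 1 &
    `|w (segment x y t) - w x - t * dot (dw x) (y - x)| <= t * e].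
Proof.
move=> sx sy e0; set M := sup_norm (y - x).
have M0 : 0 <= M by rewrite /M /sup_norm bigmax_ge_id.
(* [M + 1] rather than [M], which vanishes when [x = y] *)
pose e' := e / (M + 1).
have e'0 : 0 < e' by rewrite divr_gt0// ltr_pwDr.
have := w_C1.1 x sx e' e'0; rewrite near_withinE => near_x.
have near_segment : \forall t \near (0 : R)^'+, simplex A (segment x y t) ->
    `|w (segment x y t) - w x - dot (dw x) (segment x y t - x)| <=
      e' * sup_norm (segment x y t - x).
  have := @cvg_segment x y _ near_x.
  exact.
have [t [t0 te t1]] : exists t : R, [/\ 0 < t, t < e, t < 1 &
    simplex A (segment x y t) ->
    `|w (segment x y t) - w x - dot (dw x) (segment x y t - x)| <=
      e' * sup_norm (segment x y t - x)].
  near (0 : R)^'+ => t; exists t; split; near: t => //.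
  - exact: nbhs_right_gt.
  - exact: nbhs_right_lt.
  - exact: nbhs_right_lt.
rewrite segmentB dotZr => wt.
exists t; split=> //; apply: le_trans (wt _) _.
  by apply: segment_simplex => //; rewrite !ltW.
have tM : sup_norm (fun a => t * (y - x) a) <= t * M.
  apply: sup_norm_le => [|a]; first by rewrite mulr_ge0// ltW.
  by rewrite normrM gtr0_norm// ler_pM2l//; exact: ler_sup_norm.
apply: le_trans (ler_wpM2l (ltW e'0) tM) _.
rewrite mulrCA ler_pM2l// /e' mulrAC ler_pdivrMr ?ltr_pwDr//.
by rewrite mulrDr mulr1 lerDl ltW.
Unshelve. all: by end_near. Qed.

(** Bounding the increments of [w] along a segment to first order bounds its
    directional derivative at the origin of the segment. *)
Lemma directional_le x y (c c' : R) : simplex A x -> simplex A y ->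
  (forall t : R, 0 < t < 1 -> w (segment x y t) - w x <= t * c + t ^+ 2 * c') ->
  dot (dw x) (y - x) <= c.
Proof.
move=> sx sy wc; apply/ler_addgt0Pr => e e0.
have c1 : 0 < `|c'| + 1 by rewrite ltr_wpDl.
have [t [t0 te t1 wt]] := segment_expansion sx sy (divr_gt0 e0 c1).
have := wc t; rewrite t0 t1 => /(_ isT) {}wc.
set q := e / _ in te wt.
have eq : e = q * (`|c'| + 1) by rewrite /q divfK// gt_eqF.
have tc : t * c' <= q * `|c'|.
  apply: le_trans (ler_wpM2l (ltW t0) (ler_norm _)) _.
  by rewrite ler_wpM2r// ltW.
rewrite -(ler_pM2l t0); move: wt; rewrite ler_norml => /andP[wt _].
have := ler_wpM2l (ltW t0) tc; rewrite eq; nra.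
Qed.

Lemma directional_ge x y (c : R) : simplex A x -> simplex A y ->
  (forall t : R, 0 < t < 1 -> t * c <= w (segment x y t) - w x) ->
  c <= dot (dw x) (y - x).
Proof.
move=> sx sy wc; apply/ler_addgt0Pr => e e0.
have [t [t0 te t1 wt]] := segment_expansion sx sy e0.
have := wc t; rewrite t0 t1 => /(_ isT) {}wc.
rewrite -(ler_pM2l t0); move: wt; rewrite ler_norml => /andP[_ wt].
by nra.
Qed.

(** Strong convexity gives a quadratic lower bound on the Bregman divergence. *)
Lemma bregman_ge (N : (A -> R) -> R) x y :
  strongly_convex_on_simplex N w -> simplex A x -> simplex A y ->
  N (y - x) ^+ 2 / 2 <= bregman w dw x y.
Proof.
move=> wsc sx sy; set n := N (y - x) ^+ 2.
suff : dot (dw x) (y - x) <= w y - w x - n / 2 by rewrite /bregman; lra.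
apply: (@directional_le _ _ _ (n / 2)) => // t /andP[t0 t1].
have t01 : 0 <= t <= 1 by rewrite !ltW.
have := wsc y x t sy sx t01.
rewrite -/(segment x y t) -/n; lra.
Qed.

Lemma bregman_ge0 (N : (A -> R) -> R) x y :
  strongly_convex_on_simplex N w -> simplex A x -> simplex A y ->
  0 <= bregman w dw x y.
Proof.
move=> wsc sx sy; apply: le_trans (bregman_ge wsc sx sy).
by rewrite divr_ge0// sqr_ge0.
Qed.

Lemma bregmanxx x : bregman w dw x x = 0.
Proof. by rewrite /bregman !subrr /dot big1 ?subrr// => a _; rewrite mulr0. Qed.

(** Three-point inequality for the minimizer [z] of [F + D(x, .)]. *)
Lemma mirror_step_le (F : (A -> R) -> R) x z p :
  (forall y t, simplex A y -> 0 <= t <= 1 ->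
     F (segment z y t) <= t * F y + (1 - t) * F z) ->
  simplex A p ->
  argmin_on (simplex A) (fun y => F y + bregman w dw x y) z ->
  F z + bregman w dw x z + bregman w dw z p <= F p + bregman w dw x p.
Proof.
move=> Fc sp [sz zmin].
suff : F z - F p + dot (dw x) (p - z) <= dot (dw z) (p - z).
  by rewrite /bregman !dotBr; lra.
apply: directional_ge => // t /andP[t0 t1].
have t01 : 0 <= t <= 1 by rewrite !ltW.
have := zmin _ (segment_simplex sz sp t01); have := Fc p t sp t01.
have : dot (dw x) (segment z p t - z) = t * dot (dw x) (p - z).
  by rewrite segmentB dotZr.
by rewrite /bregman !dotBr; lra.
Qed.

End dgf.
End mirror_step.

(** * The Bellman equation for the value of a policy *)

(** Law of total probability for a variable [f] with finitely many values. *)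
Lemma measure_fin_split {R : realType} d (Omega : measurableType d)
    (P : probability Omega R) (I : finType) (f : Omega -> I) (B : set Omega) :
  (forall i, measurable [set o | f o = i]) -> measurable B ->
  P B = (\sum_i P (B `&` [set o | f o = i]))%E.
Proof.
move=> mf mB; rewrite fsbig_seq ?index_enum_uniq//= -measure_fin_bigcup//.
- congr (P _); apply/seteqP; split=> [z Bz|z [i _ []//]].
  by exists (f z) => //=; exact: mem_index_enum.
- by move=> i j _ _ [z [[_ /= <-] [_ /= <-]]].
- by move=> i _; exact: measurableI.
Qed.

(** The Bellman operator of [pi]: the expected one-step cost, plus the
    discounted expectation of [V] at the next state. *)
Definition bellman {R : realType} {S A : finType} (M : mdp R S A)
    (h : (A -> R) -> R) (pi : S -> A -> R) (V : S -> R) (s : S) : R :=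
  dot (qvec M V s) (pi s) + h (pi s).

(** The transition kernel of the state process under [pi]. *)
Definition policy_kernel {R : realType} {S A : finType} (M : mdp R S A)
    (pi : S -> A -> R) (s s' : S) : R :=
  \sum_a pi s a * trans M s a s'.

Section trajectory_value.
Context {R : realType} {S A : finType} (M : mdp R S A) (h : (A -> R) -> R).
Context (pi : S -> A -> R).
Hypotheses (pi_policy : is_policy pi) (h_ge0 : forall s, 0 <= h (pi s)).

Lemma policy_kernel_simplex s : simplex S (policy_kernel M pi s).
Proof.
have [pi0 pi1] := pi_policy s; split=> [s'|].
  by apply: sumr_ge0 => a _; rewrite mulr_ge0//; exact: (trans_simplex M s a).1.
rewrite /policy_kernel exchange_big/= -[RHS]pi1; apply: eq_bigr => a _.
by rewrite -big_distrr/= (trans_simplex M s a).2 mulr1.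
Qed.

Lemma bellmanE V s :
  bellman M h pi V s = bellman M h pi (fun=> 0) s +
    disc M * dot (policy_kernel M pi s) V.
Proof.
rewrite /bellman addrAC; congr (_ + _).
rewrite /dot /policy_kernel /qvec.
under [X in _ = X + _]eq_bigr => a _.
  rewrite big1; last by move=> *; rewrite mulr0.
  rewrite mulr0 addr0; over.
under [X in disc M * X]eq_bigr do rewrite big_distrl.
rewrite exchange_big big_distrr -big_split; apply: eq_bigr => a _ /=.
rewrite mulrDl; congr (_ + _); rewrite -mulrA; congr (_ * _).
by rewrite mulrC big_distrr; apply: eq_bigr => s' _ /=; rewrite mulrA.
Qed.

Context (s0 : S) d (Omega : measurableType d) (P : probability Omega R).
Context (X : nat -> Omega -> S * A).
Hypothesis X_traj : is_trajectory M pi s0 P X.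

(** The cost incurred at the state-action pair [x]. *)
Let r (x : S * A) : R := cost M x.1 x.2 + h (pi x.1).

Let r_ge0 x : 0 <= r x.
Proof. by rewrite addr_ge0//; case/andP: (cost_itv M x.1 x.2). Qed.

(** The probability that [(s_t, a_t) = x]. *)
Let marg t x : R := fine (P [set o | X t o = x]).

Let margE t x : P [set o | X t o = x] = (marg t x)%:E.
Proof. by rewrite /marg fineK// fin_num_measure//; exact: X_traj.1. Qed.

(** The transition kernel of the state-action process. *)
Let step (x y : S * A) : R := trans M x.1 x.2 y.1 * pi y.1 y.2.

Let path_measurable n (x : nat -> S * A) :
  measurable [set o | forall i, (i <= n)%N -> X i o = x i].
Proof.
rewrite (_ : [set _ | _] =
    \bigcap_(i in [set i | (i <= n)%N]) [set o | X i o = x i])//.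
apply: bigcap_measurable => [|i _]; last exact: X_traj.1.
by exists 0.
Qed.

Let marg0 x : marg 0 x = (x.1 == s0)%:R * pi x.1 x.2.
Proof.
apply: EFin_inj; rewrite -margE.
have := X_traj.2 0 (fun=> x); rewrite big_ord0 mulr1 => <-.
congr (P _); apply/seteqP; split=> [z /= Xz i|z /=]; last exact.
by rewrite leqn0 => /eqP ->.
Qed.

(** The Markov property, obtained from the cylinder probabilities by
    conditioning on the whole path up to time [t]. *)
Let margS t y : marg t.+1 y = \sum_x marg t x * step x y.
Proof.
apply: EFin_inj; rewrite -margE.
pose f o := [ffun i : 'I_t.+1 => X i o].
have fE g : [set o | f o = g] =
    [set o | forall i, (i <= t)%N -> X i o = g (inord i)].
  apply/seteqP; split=> o /=; first by move=> <- i it; rewrite ffunE inordK.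
  by move=> H; apply/ffunP => i; rewrite ffunE H ?inord_val// -ltnS.
have mf g : measurable [set o | f o = g] by rewrite fE; exact: path_measurable.
rewrite (measure_fin_split P mf (X_traj.1 _ _)).
pose c g := fine (P [set o | f o = g]).
have cE g : P [set o | f o = g] = (c g)%:E.
  by rewrite /c fineK// fin_num_measure.
have split_last g :
    P ([set o | X t.+1 o = y] `&` [set o | f o = g]) =
    (c g * step (g ord_max) y)%:E.
  pose x i := if (i <= t)%N then g (inord i) else y.
  have -> : [set o | X t.+1 o = y] `&` [set o | f o = g] =
      [set o | forall i, (i <= t.+1)%N -> X i o = x i].
    rewrite fE /x; apply/seteqP; split=> o /=.
      move=> [Xy Xg] i; rewrite leq_eqVlt => /predU1P[->|].
        by rewrite ltnn.
      by rewrite ltnS => it; rewrite it Xg.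
    move=> H; split; first by rewrite H// ltnn.
    by move=> i it; rewrite H ?leqW// it.
  rewrite X_traj.2 big_ord_recr/= mulrA; congr (EFin _).
  have -> : c g = (((x 0).1 == s0)%:R * pi (x 0).1 (x 0).2 *
      \prod_(i < t) (trans M (x i).1 (x i).2 (x i.+1).1 *
                     pi (x i.+1).1 (x i.+1).2)).
    apply: EFin_inj; rewrite -cE -X_traj.2 fE; congr (P _).
    by apply/seteqP; split=> o /= H i it; have := H i it; rewrite /x it.
  have -> : x t = g ord_max.
    by rewrite /x leqnn; congr (g _); apply: val_inj; rewrite /= inordK.
  by rewrite /x ltnn.
under eq_bigr do rewrite split_last.
rewrite sumEFin; congr (EFin _).
(* group the paths [g] by their last state-action pair *)
transitivity (\sum_(g : {ffun 'I_t.+1 -> S * A}) \sum_x (x == g ord_max)%:R * (c g * step x y)).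
  apply: eq_bigr => g _; rewrite (bigD1 (g ord_max))//= eqxx mul1r.
  by rewrite big1 ?addr0// => x /negbTE ->; rewrite mul0r.
rewrite exchange_big/=; apply: eq_bigr => x _.
have -> : marg t x = \sum_(g : {ffun 'I_t.+1 -> S * A}) (x == g ord_max)%:R * c g.
  apply: EFin_inj; rewrite -margE (measure_fin_split P mf (X_traj.1 _ _)).
  rewrite -sumEFin; apply: eq_bigr => g _.
  have [->|xg] := eqVneq x (g ord_max).
    rewrite mul1r -cE; congr (P _); apply/seteqP; split=> o /= => [[]//|fg].
    by split=> //; rewrite -fg ffunE.
  rewrite mul0r (_ : _ `&` _ = set0) ?measure0//.
  apply/seteqP; split=> o //= -[Xx fg]; move/eqP: xg; apply.
  by rewrite -Xx -fg ffunE.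
by rewrite big_distrl; apply: eq_bigr => g _ /=; rewrite mulrA.
Qed.

Let marg_ge0 t x : 0 <= marg t x.
Proof. by rewrite /marg fine_ge0. Qed.

Let marg1 t : \sum_x marg t x = 1.
Proof.
apply: EFin_inj; rewrite -sumEFin -(@probability_setT _ _ _ P).
rewrite (measure_fin_split P (X_traj.1 t) measurableT).
by apply: eq_bigr => x _; rewrite setTI margE.
Qed.

Context (V : S -> R).
Hypothesis V_fix : forall s, V s = bellman M h pi V s.

Let V_expand s :
  V s = \sum_a pi s a * (r (s, a) + disc M * dot (trans M s a) V).
Proof.
rewrite V_fix /bellman -[h _](simplex_dot_cst _ (pi_policy s)) /dot -big_split.
apply: eq_bigr => a _; rewrite /= [X in X + _]mulrC -mulrDr /qvec /r /=.
by congr (_ * _); rewrite addrAC.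
Qed.

(** The marginal law of [(s_t, a_t)] disintegrates along the policy. *)
Let marg_policy t :
  exists nu : S -> R, forall x, marg t x = nu x.1 * pi x.1 x.2.
Proof.
case: t => [|t]; first by exists (fun s => (s == s0)%:R) => x; exact: marg0.
exists (fun s => \sum_x marg t x * trans M x.1 x.2 s) => y.
by rewrite margS big_distrl; apply: eq_bigr => x _ /=; rewrite mulrA.
Qed.

(** The expectation of [f (s_t, a_t)]. *)
Let mean t (f : S * A -> R) : R := \sum_x marg t x * f x.

Let mean_V0 : mean 0 (fun x => V x.1) = V s0.
Proof.
rewrite /mean; under eq_bigr do rewrite marg0.
rewrite -(pair_bigA _ (fun s a => (s == s0)%:R * pi s a * V s))/=.
rewrite (bigD1 s0)//= [X in _ + X]big1 ?addr0; last first.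
  by move=> s /negbTE ->; rewrite big1// => a _; rewrite !mul0r.
by rewrite -big_distrl -big_distrr/= eqxx (pi_policy s0).2 !mul1r.
Qed.

Let mean_V_step t :
  mean t (fun x => V x.1) = mean t r + disc M * mean t.+1 (fun x => V x.1).
Proof.
have -> : mean t.+1 (fun x => V x.1) =
    mean t (fun x => dot (trans M x.1 x.2) V).
  rewrite /mean; under eq_bigr do rewrite margS big_distrl/=.
  rewrite exchange_big; apply: eq_bigr => x _ /=.
  under eq_bigr do rewrite -mulrA; rewrite -big_distrr; congr (_ * _).
  rewrite -(pair_bigA _ (fun s a => step x (s, a) * V s))/=.
  apply: eq_bigr => s _; rewrite /step/= -big_distrl -big_distrr/=.
  by rewrite (pi_policy s).2 mulr1.
have [nu nuE] := marg_policy t.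
rewrite /mean big_distrr -big_split/=.
under eq_bigr do rewrite nuE.
under [RHS]eq_bigr do rewrite nuE mulrCA -mulrDr.
rewrite -(pair_bigA _ (fun s a => nu s * pi s a * V s))/=.
rewrite -(pair_bigA _ (fun s a => nu s * pi s a *
  (r (s, a) + disc M * dot (trans M s a) V)))/=.
apply: eq_bigr => s _; rewrite -big_distrl -big_distrr/= (pi_policy s).2 mulr1.
by rewrite [in LHS]V_expand big_distrr; apply: eq_bigr => a _ /=; rewrite mulrA.
Qed.

(** Iterating the fixed-point equation of [V] along the trajectory. *)
Let sum_mean n : \sum_(0 <= t < n) disc M ^+ t * mean t r =
  V s0 - disc M ^+ n * mean n (fun x => V x.1).
Proof.
elim: n => [|n IH]; first by rewrite big_nil expr0 mul1r mean_V0 subrr.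
rewrite big_nat_recr//= IH mean_V_step exprS; ring.
Qed.

Let mean_le t (f : S * A -> R) : `|mean t f| <= sup_norm f.
Proof.
apply: le_trans (ler_norm_sum _ _ _) _.
rewrite -[leRHS]mul1r -(marg1 t) big_distrl/=; apply: ler_sum => x _.
by rewrite normrM ger0_norm// ler_wpM2l//; exact: ler_sup_norm.
Qed.

Let cvg_sum_mean :
  \sum_(0 <= t < n) disc M ^+ t * mean t r @[n --> \oo] --> V s0.
Proof.
case/andP: (disc_itv M) => g0 g1.
set C := sup_norm (fun x : S * A => V x.1).
have cvC : geometric C (disc M) n @[n --> \oo] --> 0.
  by apply: cvg_geometric; rewrite gtr0_norm.
have cvW : disc M ^+ n * mean n (fun x => V x.1) @[n --> \oo] --> 0.
  have cvNC : (fun n => - geometric C (disc M) n) @ \oo --> - (0 : R).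
    exact: cvgN.
  rewrite oppr0 in cvNC; apply: (squeeze_cvgr _ cvNC cvC).
  near=> n; rewrite -ler_norml normrM (ger0_norm (exprn_ge0 n (ltW g0))).
  by rewrite [leRHS]mulrC ler_wpM2l ?(exprn_ge0 n (ltW g0))//; exact: mean_le.
under eq_cvg do rewrite sum_mean.
by have := cvgB (cvg_cst (V s0)) cvW; rewrite subr0; exact.
Unshelve. all: by end_near. Qed.

Let integral_stage (f : S * A -> R) t : (forall x, 0 <= f x) ->
  measurable_fun setT (fun o => (f (X t o))%:E) /\
  (\int[P]_o (f (X t o))%:E = (mean t f)%:E)%E.
Proof.
move=> f0; have fE : (fun o => (f (X t o))%:E) =
    (fun o => \sum_x (f x)%:E * (\1_[set o | X t o = x] o)%:E)%E.
  apply/funext => o; rewrite (bigD1 (X t o))//= indicE mem_set// mule1.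
  rewrite big1 ?adde0// => x xX; rewrite indicE memNset ?mule0//= => /eqP.
  by rewrite eq_sym (negbTE xX).
have mf x : measurable_fun setT
    (fun o => ((f x)%:E * (\1_[set o | X t o = x] o)%:E)%E).
  apply: measurable_funeM; apply/measurable_EFinP.
  by apply: measurable_indic; exact: X_traj.1.
split; first by rewrite fE; exact: emeasurable_sum.
rewrite fE ge0_integral_sum//.
  rewrite -sumEFin; apply: eq_bigr => x _; rewrite ge0_integralZl_EFin//.
  - rewrite integral_indic//; last exact: X_traj.1.
    by rewrite setIT [X in (_ * X)%E](margE t x) -EFinM mulrC.
  - apply/measurable_EFinP.
    by apply: measurable_indic; exact: X_traj.1.
by move=> x o _; rewrite mule_ge0// lee_fin.
Qed.

Let discounted_costE o : (discounted_cost M h pi (X ^~ o))%:E =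
  (\sum_(0 <= t <oo) (disc M ^+ t * r (X t o))%:E)%E.
Proof.
case/andP: (disc_itv M) => g0 g1; have gn t := exprn_ge0 t (ltW g0).
rewrite -EFin_lim; first by congr (limn _); apply/funext => n; rewrite /= -sumEFin.
apply: (@series_le_cvg _ _ (geometric (sup_norm r) (disc M))) => [t|t|t|].
- by rewrite mulr_ge0//; exact: r_ge0.
- by rewrite mulr_ge0// /sup_norm bigmax_ge_id.
- rewrite /= mulrC ler_wpM2r//.
  exact: le_trans (ler_norm _) (ler_sup_norm r _).
- by apply: is_cvg_geometric_series; rewrite gtr0_norm.
Qed.

(** Expectation and infinite sum are exchanged because the costs are
    nonnegative. *)
Lemma expected_discounted_cost :
  ('E_P[fun o => discounted_cost M h pi (X ^~ o)] = (V s0)%:E)%E.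
Proof.
have g0 t : 0 <= disc M ^+ t by rewrite exprn_ge0 ?ltW//; case/andP: (disc_itv M).
rewrite unlock; under eq_integral do rewrite discounted_costE.
rewrite integral_nneseries//; last first.
- by move=> t o _; rewrite lee_fin mulr_ge0//; exact: r_ge0.
- move=> t; under eq_fun do rewrite EFinM.
  by apply: measurable_funeM; exact: (integral_stage t r_ge0).1.
rewrite (eq_eseriesr (g := fun t => (disc M ^+ t * mean t r)%:E)); last first.
  move=> t _; have [mr int_r] := integral_stage t r_ge0.
  rewrite EFinM -int_r -ge0_integralZl_EFin//.
  by move=> o _; rewrite lee_fin; exact: r_ge0.
rewrite -(cvg_lim _ cvg_sum_mean)// -EFin_lim; last by apply/cvg_ex; exists (V s0).
by congr (limn _); apply/funext => n; rewrite /= -sumEFin.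
Qed.

End trajectory_value.

(** A policy with nonnegative costs has as value any fixed point of its Bellman
    operator; such a fixed point is provided by the discounted resolvent. *)
Lemma value_bellman {R : realType} {S A : finType} (M : mdp R S A)
    (h : (A -> R) -> R) (pi : S -> A -> R) :
  is_policy pi -> (forall s, 0 <= h (pi s)) ->
  forall s, value M h pi s = bellman M h pi (value M h pi) s.
Proof.
move=> pip h0; have /andP[g0 g1] := disc_itv M.
have g01 : 0 <= disc M < 1 by rewrite ltW.
have [G [_ _ _ LG]] := discounted_resolvent (policy_kernel_simplex M pip) g01.
pose V s := dot (G s) (bellman M h pi (fun=> 0)).
have V_fix s : V s = bellman M h pi V s.
  by rewrite bellmanE// -[X in X + _]LG subrK.
suff -> : value M h pi = V by [].
apply/funext => s; rewrite /value; case: xgetP => [v _ |noV].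
  move=> [d [T [P [X [Xt vE]]]]]; apply: EFin_inj.
  by rewrite vE (expected_discounted_cost pip h0 Xt V_fix).
have [d [T [P [X Xt]]]] := trajectory_exists M s pip.
case: (noV (V s)); exists d, T, P, X; split=> //.
by rewrite (expected_discounted_cost pip h0 Xt V_fix).
Qed.

(** * Policy values and one epoch of the algorithm *)

Section policy_values.
Context {R : realType} {S A : finType} (M : mdp R S A) (h : (A -> R) -> R).
Context (hbar : R).
Hypothesis h_itv : forall p, simplex A p -> 0 <= h p <= hbar.
Context (pi : S -> A -> R).
Hypothesis pi_policy : is_policy pi.

Let h_ge0 s : 0 <= h (pi s).
Proof. by case/andP: (h_itv (pi_policy s)). Qed.

Lemma disc_itvW : 0 <= disc M < 1.
Proof. by case/andP: (disc_itv M) => /ltW -> ->. Qed.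

Lemma bellmanB V W s :
  bellman M h pi V s - bellman M h pi W s =
  disc M * dot (policy_kernel M pi s) (V - W).
Proof. by rewrite (bellmanE _ _ _ V) (bellmanE _ _ _ W) dotBr; ring. Qed.

Lemma le_bellman V W s : (forall s, V s <= W s) ->
  bellman M h pi V s <= bellman M h pi W s.
Proof.
move=> VW; rewrite -subr_ge0 bellmanB mulr_ge0//; first by case/andP: disc_itvW.
have [P0 _] := policy_kernel_simplex M pi_policy s.
by apply: sumr_ge0 => s' _; rewrite mulr_ge0// subr_ge0.
Qed.

Lemma bellman0_itv s : 0 <= bellman M h pi (fun=> 0) s <= 1 + hbar.
Proof.
have [pi0 pi1] := pi_policy s; case/andP: (h_itv (pi_policy s)) => h0 h1.
have -> : bellman M h pi (fun=> 0) s = dot (pi s) (cost M s) + h (pi s).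
  rewrite /bellman; congr (_ + _); apply: eq_bigr => a _.
  by rewrite mulrC /qvec big1 ?mulr0 ?addr0// => *; rewrite mulr0.
apply/andP; split.
  rewrite addr_ge0//; apply: sumr_ge0 => a _; rewrite mulr_ge0//.
  by case/andP: (cost_itv M s a).
rewrite lerD//; apply: simplex_dot_le => // a.
by case/andP: (cost_itv M s a).
Qed.

(** A supersolution of the Bellman equation dominates the value. *)
Lemma value_le_supersolution V : (forall s, bellman M h pi V s <= V s) ->
  forall s, value M h pi s <= V s.
Proof.
move=> BV s; rewrite -subr_ge0.
apply: (discounted_min_principle (policy_kernel_simplex M pi_policy) disc_itvW
  (f := V - value M h pi)) => {}s.
rewrite -bellmanB -(value_bellman M pi_policy h_ge0).
exact: lerB (BV s) (lexx _).
Qed.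

Lemma value_ge0 s : 0 <= value M h pi s.
Proof.
apply: (discounted_min_principle (policy_kernel_simplex M pi_policy) disc_itvW).
move=> {}s; rewrite [leRHS](value_bellman M pi_policy h_ge0) bellmanE lerDr.
by case/andP: (bellman0_itv s).
Qed.

(** The initial value vector of the algorithm is a supersolution. *)
Lemma bellman_cst_le s (c := (1 + hbar) / (1 - disc M)) :
  bellman M h pi (fun=> c) s <= c.
Proof.
have /andP[g0 g1] := disc_itvW.
rewrite bellmanE (simplex_dot_cst _ (policy_kernel_simplex M pi_policy s)).
have : bellman M h pi (fun=> 0) s <= 1 + hbar by case/andP: (bellman0_itv s).
have -> : 1 + hbar = c - disc M * c.
  by rewrite -[X in X - _]mul1r -mulrBl mulrC divfK// subr_eq0 gt_eqF.
lra.
Qed.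

End policy_values.

Section epoch.
Context {R : realType} {S A : finType} (M : mdp R S A) (h : (A -> R) -> R).
Context (hbar : R).
Hypothesis h_itv : forall p, simplex A p -> 0 <= h p <= hbar.
Hypothesis h_convex : convex_on_simplex h.
Context (N : (A -> R) -> R) (w : (A -> R) -> R) (dw : (A -> R) -> (A -> R)).
Hypothesis w_C1 : C1_on_simplex w dw.
Hypothesis w_sc : strongly_convex_on_simplex N w.

Section step.
Context (eta : R) (q x z : A -> R).
Hypotheses (eta_gt0 : 0 < eta) (sx : simplex A x).
Hypothesis z_argmin : argmin_on (simplex A)
  (fun p => eta * (dot q p + h p) + bregman w dw x p) z.

(** The three-point inequality divided by the step size, without the nonnegative
    term [D(x, z)]. *)
Lemma prox_le p : simplex A p ->
  dot q z + h z <=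
  dot q p + h p + eta^-1 * (bregman w dw x p - bregman w dw z p).
Proof.
move=> sp; have sz := z_argmin.1.
have Fc y t : simplex A y -> 0 <= t <= 1 ->
    eta * (dot q (segment z y t) + h (segment z y t)) <=
    t * (eta * (dot q y + h y)) + (1 - t) * (eta * (dot q z + h z)).
  move=> sy t01; rewrite !(mulrCA _ eta) -mulrDr ler_pM2l//.
  have -> : segment z y t = (fun a => t * y a) + (fun a => (1 - t) * z a) by [].
  rewrite dotDr !dotZr.
  have := convex_on_simplexP h_convex sz sy t01.
  by rewrite /segment; lra.
have := mirror_step_le w_C1 Fc sp z_argmin.
have := bregman_ge0 w_C1 w_sc sx sz.
set a := bregman w dw x p; set b := bregman w dw z p => D0 three.
rewrite -(ler_pM2l eta_gt0) [leRHS]mulrDr [X in _ <= _ + X]mulrA.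
by rewrite divff ?gt_eqF// mul1r; lra.
Qed.

Lemma prox_descent : dot q z + h z <= dot q x + h x.
Proof.
have := z_argmin.2 _ sx; rewrite bregmanxx addr0.
have := bregman_ge0 w_C1 w_sc sx z_argmin.1.
by move=> D0 /(le_trans _) zx; rewrite -(ler_pM2l eta_gt0) zx// lerDl.
Qed.

End step.

Context (T : nat) (eta : R) (p : nat -> S -> A -> R) (W : nat -> S -> R).
Hypothesis eta_gt0 : 0 < eta.
Hypothesis p0_policy : is_policy (p 0).
Hypothesis W0_super : forall s, bellman M h (p 0) (W 0) s <= W 0 s.
Hypothesis p_step : forall t s, (t < T)%N -> argmin_on (simplex A)
  (fun x => eta * (dot (qvec M (W t) s) x + h x) + bregman w dw (p t s) x)
  (p t.+1 s).
Hypothesis W_step : forall t s, (t < T)%N ->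
  W t.+1 s = dot (qvec M (W t) s) (p t.+1 s) + h (p t.+1 s).

Lemma epoch_policy t : (t <= T)%N -> is_policy (p t).
Proof. by case: t => [//|t] tT s; exact: (p_step s tT).1. Qed.

Let W_descent t : (t < T)%N -> (forall s, bellman M h (p t) (W t) s <= W t s) ->
  forall s, W t.+1 s <= W t s.
Proof.
move=> tT Wt s; rewrite W_step//; apply: le_trans (Wt s).
exact: prox_descent eta_gt0 (epoch_policy (ltnW tT) s) (p_step s tT).
Qed.

(** The values of an epoch stay supersolutions of the current Bellman
    equation, hence upper bounds of the value of the current policy. *)
Lemma epoch_supersolution t : (t <= T)%N ->
  forall s, bellman M h (p t) (W t) s <= W t s.
Proof.
elim: t => [//|t IH] tT s; rewrite [leRHS]W_step//.
rewrite -[leRHS]/(bellman M h (p t.+1) (W t) s).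
apply: (le_bellman M h (epoch_policy tT)) => s'.
by apply: W_descent => //; apply: IH; exact: ltnW.
Qed.

Lemma epoch_descent t s : (t < T)%N -> W t.+1 s <= W t s.
Proof. by move=> tT; apply: W_descent => //; exact/epoch_supersolution/ltnW. Qed.

Let W_ge_last t s : (t <= T)%N -> W T s <= W t s.
Proof.
move=> tT; rewrite -(subKn tT); move: (T - t)%N (leq_subr t T) => n.
elim: n => [|n IH] nT; first by rewrite subn0.
apply: le_trans (IH (ltnW nT)) _.
have -> : (T - n = (T - n.+1).+1)%N by rewrite subnSK.
by apply: epoch_descent; rewrite ltn_subrL (leq_trans _ nT).
Qed.

Context (q : S -> A -> R) (u : R).
Hypothesis q_optimal : is_optimal M h q.
Hypothesis u_ge0 : 0 <= u.
Hypothesis W0_gap : forall s, W 0 s - value M h q s <= u.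
Context (G : S -> S -> R).
Hypothesis G_ge0 : forall s s', 0 <= G s s'.
Hypothesis G_sum : forall s, \sum_s' G s s' = (1 - disc M)^-1.
Hypothesis G_resolvent : forall f s,
  dot (G s) (fun s' => f s' - disc M * dot (policy_kernel M q s') f) = f s.

(** Summing the proximal inequalities over the epoch and applying the resolvent
    of the optimal policy telescopes the resolvent-averaged divergences. *)
Lemma epoch_gap s
    (Phi := fun x : S -> A -> R =>
       dot (G s) (fun s' => bregman w dw (x s') (q s'))) :
  T%:R * (W T s - value M h q s) <=
  u / (1 - disc M) + eta^-1 * (Phi (p 0) - Phi (p T)).
Proof.
have [q_policy q_min] := q_optimal; have /andP[g0 g1] := disc_itvW M.
have h_ge0 s' : 0 <= h (q s') by case/andP: (h_itv (q_policy s')).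
pose e t s' := W t s' - value M h q s'.
pose D t s' := bregman w dw (p t s') (q s').
have Pq s' : simplex S (policy_kernel M q s') by exact: policy_kernel_simplex.
have e_ge0 t s' : (t <= T)%N -> 0 <= e t s'.
  move=> tT; rewrite subr_ge0; apply: le_trans (q_min _ (epoch_policy tT) s') _.
  exact: (value_le_supersolution h_itv (epoch_policy tT)
    (epoch_supersolution tT)).
have e_step t s' : (t < T)%N -> e t.+1 s' <=
    disc M * dot (policy_kernel M q s') (e t) + eta^-1 * (D t s' - D t.+1 s').
  move=> tT.
  have := prox_le eta_gt0 (epoch_policy (ltnW tT) s') (p_step s' tT) (q_policy s').
  rewrite -W_step// -[_ + h (q s')]/(bellman M h q (W t) s') => Wle.
  have := bellmanB M h q (W t) (value M h q) s'.
  rewrite -(value_bellman M q_policy h_ge0) /e => <-.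
  by rewrite /D; lra.
pose E s' := \sum_(t < T) e t.+1 s'.
have E_le s' : E s' - disc M * dot (policy_kernel M q s') E <=
    u + eta^-1 * (D 0 s' - D T s').
  rewrite /E dot_sumr big_distrr -sumrB/=.
  (* subtracting the discounted mean of [e t.+1] from [e_step] leaves the
     telescoping term [Z t - Z t.+1] *)
  pose Z t := disc M * dot (policy_kernel M q s') (e t) + eta^-1 * D t s'.
  apply: (@le_trans _ _ (\sum_(t < T) (Z t - Z t.+1))).
    by apply: ler_sum => t _; have := e_step t s' (ltn_ord t); rewrite /Z; lra.
  rewrite -(big_mkord xpredT (fun t => Z t - Z t.+1)).
  under eq_bigr do rewrite -opprB.
  rewrite sumrN telescope_sumr// opprB.
  have e0u : dot (policy_kernel M q s') (e 0) <= u by exact: simplex_dot_le.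
  have eT0 : 0 <= dot (policy_kernel M q s') (e T).
    apply: sumr_ge0 => s'' _; rewrite mulr_ge0 ?e_ge0//; exact: (Pq s').1.
  have := ler_wpM2l g0 e0u; have := mulr_ge0 g0 eT0.
  have : disc M * u <= u by rewrite ler_piMl// ltW.
  by rewrite /Z; lra.
have EGs : E s <= u / (1 - disc M) + eta^-1 * (Phi (p 0) - Phi (p T)).
  rewrite -(G_resolvent E s); apply: le_trans (ler_dotr (G_ge0 s) E_le) _.
  rewrite (_ : (fun s' => _) = (fun=> u) + (fun s' => eta^-1 * (D 0 - D T) s'))//.
  by rewrite dotDr dot_cst G_sum dotZr dotBr mulrC.
apply: le_trans EGs; rewrite mulr_natl -[X in _ *+ X]card_ord -sumr_const.
by apply: ler_sum => t _; rewrite lerD2r; exact: W_ge_last.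
Qed.

End epoch.

(** * Induction over the epochs *)

Section vmd.
Context {R : realType} {S A : finType} (M : mdp R S A).
Context (hbar : R) (h : (A -> R) -> R).
Hypothesis h_convex : convex_on_simplex h.
Hypothesis h_itv : forall p, simplex A p -> 0 <= h p <= hbar.
Context (N : (A -> R) -> R) (w : (A -> R) -> R) (dw : (A -> R) -> (A -> R)).
Hypothesis w_C1 : C1_on_simplex w dw.
Hypothesis w_sc : strongly_convex_on_simplex N w.
Context (pistar : S -> A -> R).
Hypothesis pistar_optimal : is_optimal M h pistar.

(** When the divergence bound is positive, every epoch halves the bound [u k] on
    the gap between the current values and the optimal one, and at most doubles
    the bound on the averaged divergence from the current policy to the optimal
    one. *)
Lemma vmd_gap (D0 : R) (K T : nat) (u : nat -> R) (eta : nat -> nat -> R)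
    (hatpi : nat -> S -> A -> R) (hatV : nat -> S -> R)
    (pi : nat -> nat -> S -> A -> R) (V : nat -> nat -> S -> R) :
  0 < D0 ->
  (forall s, bregman w dw (uniform A) (pistar s) <= D0) ->
  4 <= (1 - disc M) * T%:R ->
  (forall k, u k = (1 + hbar) / (2 ^+ k * (1 - disc M))) ->
  (forall k t, (k < K)%N -> (t < T)%N -> eta k t = 2 ^+ k * D0 / u k) ->
  vmd_run M h w dw hbar K T eta hatpi hatV pi V ->
  forall s, 0 <= value M h (hatpi K) s - value M h pistar s <= u K.
Proof.
move=> D0_gt0 D0_bound T4 uE etaE run s0.
have [ps_policy ps_min] := pistar_optimal.
have [a0 _] := simplex_inhabited (ps_policy s0).
have /andP[g0 g1] := disc_itvW M; have g1' : 0 < 1 - disc M by rewrite subr_gt0.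
have hbar_ge0 : 0 <= hbar.
  by case/andP: (h_itv (ps_policy s0)); exact: le_trans.
have u_gt0 k : 0 < u k.
  by rewrite uE divr_gt0 ?mulr_gt0 ?exprn_gt0// ltr_wpDr.
have uS k : u k.+1 = u k / 2.
  by rewrite !uE exprS -mulrA invfM [2^-1 * _]mulrC mulrA.
have [G [G0 G1 GL _]] :=
  discounted_resolvent (policy_kernel_simplex M ps_policy) (disc_itvW M).
(* the factor [1 - disc M] turns the rows of [G] into probability vectors *)
pose Phi (x : S -> A -> R) s := (1 - disc M) *
  dot (G s) (fun s' => bregman w dw (x s') (pistar s')).
have Phi_ge0 x s : is_policy x -> 0 <= Phi x s.
  move=> xp; apply: mulr_ge0; first exact: ltW.
  apply: sumr_ge0 => s' _.
  by rewrite mulr_ge0//; apply: (bregman_ge0 w_C1 w_sc).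
have step k : (k <= K)%N -> [/\ is_policy (hatpi k),
    forall s, bellman M h (hatpi k) (hatV k) s <= hatV k s,
    forall s, hatV k s - value M h pistar s <= u k &
    forall s, Phi (hatpi k) s <= 2 ^+ k * D0].
  elim: k => [_|k IH kK].
    have hp0 : is_policy (hatpi 0).
      by move=> s; rewrite (vmd_pi0 run); exact: uniform_simplex.
    have hV0 : hatV 0 = fun=> (1 + hbar) / (1 - disc M).
      by apply/funext => s; exact: (vmd_V0 run).
    split=> // s.
    - by rewrite hV0; exact: bellman_cst_le.
    - by rewrite hV0 uE expr0 mul1r gerBl; exact: (value_ge0 M h_itv ps_policy).
    - rewrite expr0 mul1r /Phi -ler_pdivlMl// -(G1 s) -dot_cst.
      by apply: ler_dotr => // s'; rewrite (vmd_pi0 run).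
  have [xp xV xu xPhi] := IH (ltnW kK).
  set eta_k := 2 ^+ k * D0 / u k.
  have eta_gt0 : 0 < eta_k by rewrite divr_gt0// mulr_gt0// exprn_gt0.
  have p0E := vmd_epoch_pi0 run kK; have V0E := vmd_epoch_V0 run kK.
  have p_step t s : (t < T)%N -> argmin_on (simplex A)
      (fun x => eta_k * (dot (qvec M (V k t) s) x + h x) +
         bregman w dw (pi k t s) x) (pi k t.+1 s).
    by move=> tT; have := vmd_policy_step run s kK tT; rewrite etaE.
  have V_step t s : (t < T)%N -> V k t.+1 s =
      dot (qvec M (V k t) s) (pi k t.+1 s) + h (pi k t.+1 s).
    by move=> tT; exact: (vmd_value_step run s kK tT).
  rewrite (vmd_epoch_pi run kK) (vmd_epoch_V run kK).
  rewrite -p0E -V0E in xp xV xu xPhi.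
  have Tp := epoch_policy xp p_step (leqnn T).
  have TV := epoch_supersolution w_C1 w_sc eta_gt0 xp xV p_step V_step
    (leqnn T).
  have gap s : 4 * (V k T s - value M h pistar s) <=
      u k + eta_k^-1 * (Phi (pi k 0) s - Phi (pi k T) s).
    have := epoch_gap h_itv h_convex w_C1 w_sc eta_gt0 xp xV p_step V_step
      pistar_optimal (ltW (u_gt0 k)) xu G0 G1 GL s.
    move=> /(ler_wpM2l (ltW g1')); rewrite [leLHS]mulrA [leRHS]mulrDr.
    rewrite [X in _ <= X + _]mulrCA divff ?gt_eqF// mulr1.
    rewrite [X in _ <= _ + X]mulrCA [X in _ <= _ + _ * X]mulrBr; apply: le_trans.
    rewrite ler_wpM2r// subr_ge0; apply: le_trans (ps_min _ Tp s) _.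
    exact: (value_le_supersolution h_itv Tp TV).
  have e_ge0 s : 0 <= V k T s - value M h pistar s.
    rewrite subr_ge0; apply: le_trans (ps_min _ Tp s) _.
    exact: (value_le_supersolution h_itv Tp TV).
  have eta_u : eta_k^-1 * (2 ^+ k * D0) = u k.
    by rewrite /eta_k invf_div divfK// gt_eqF// mulr_gt0// exprn_gt0.
  have iB x : x <= 2 ^+ k * D0 -> eta_k^-1 * x <= u k.
    by move=> xB; rewrite -eta_u ler_pM2l// invr_gt0.
  split=> // s.
  - rewrite uS; have := gap s; have := iB _ (xPhi s).
    have : 0 <= eta_k^-1 * Phi (pi k T) s.
      by rewrite mulr_ge0 ?invr_ge0 ?Phi_ge0// ltW.
    by rewrite mulrBr; lra.
  - have /ltW i0 : 0 < eta_k^-1 by rewrite invr_gt0.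
    rewrite -(ler_pM2l (x := eta_k^-1)) ?invr_gt0//.
    have := gap s; have := e_ge0 s; have := iB _ (xPhi s).
    have -> : eta_k^-1 * (2 ^+ k.+1 * D0) = 2 * u k.
      by rewrite -eta_u exprS -mulrA mulrCA.
    by rewrite mulrBr; lra.
have [Kp KV Ku _] := step K (leqnn K).
rewrite subr_ge0 ps_min//= (le_trans _ (Ku s0))// lerD2r.
exact: (value_le_supersolution h_itv Kp KV).
Qed.

(** If no divergence from the uniform distribution is positive, the simplex is a
    singleton. *)
Lemma simplex_singleton : is_norm N ->
  (forall p, simplex A p -> bregman w dw (uniform A) p <= 0) ->
  forall p : A -> R, simplex A p -> p = uniform A.
Proof.
move=> [_ _ N_eq0] B0 p sp.
have [a0 _] := simplex_inhabited sp.
apply/eqP; rewrite -subr_eq0; apply/eqP/N_eq0/eqP; rewrite -sqrf_eq0 eq_le sqr_ge0.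
rewrite andbT -[X in _ <= X](mul0r 2) -ler_pdivrMr//.
by apply: le_trans (B0 p sp); apply: (bregman_ge w_C1 w_sc) => //; exact: uniform_simplex.
Qed.

End vmd.

Theorem theorem1 (R : realType) (S A : finType) (M : mdp R S A)
  (hbar : R) (h : (A -> R) -> R)
  (h_continuous : continuous_on_simplex h)
  (h_convex : convex_on_simplex h)
  (h_itv : forall p, simplex A p -> 0 <= h p <= hbar)
  (N : (A -> R) -> R) (N_norm : is_norm N)
  (w : (A -> R) -> R) (dw : (A -> R) -> (A -> R))
  (w_C1 : C1_on_simplex w dw)
  (w_strongly_convex : strongly_convex_on_simplex N w)
  (pistar : S -> A -> R) (pistar_optimal : is_optimal M h pistar)
  (eps : R) (eps_gt0 : 0 < eps)
  (D0 : R)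
  (D0_bound : forall pi : S -> A -> R, is_policy pi ->
     sup_norm (fun s => bregman w dw (uniform A) (pi s)) <= D0)
  (K T : nat)
  (K_def : K%:Z = Num.ceil (ln ((1 + hbar) / ((1 - disc M) * eps)) / ln 2))
  (T_def : T%:Z = Num.ceil (4 / (1 - disc M)))
  (u : nat -> R)
  (u_def : forall k, u k = (1 + hbar) / (2 ^+ k * (1 - disc M)))
  (eta : nat -> nat -> R)
  (eta_def : forall k t, (k < K)%N -> (t < T)%N ->
     eta k t = 2 ^+ k * D0 / u k)
  (hatpi : nat -> S -> A -> R) (hatV : nat -> S -> R)
  (pi : nat -> nat -> S -> A -> R) (V : nat -> nat -> S -> R)
  (run : vmd_run M h w dw hbar K T eta hatpi hatV pi V) :
  sup_norm (fun s => value M h (hatpi K) s - value M h pistar s) <= eps.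
Proof.
apply: sup_norm_le => [|s]; first exact: ltW.
have [ps_policy _] := pistar_optimal.
have /andP[g0 g1] := disc_itvW M; have g1' : 0 < 1 - disc M by rewrite subr_gt0.
have c_gt0 : 0 < 1 + hbar.
  by case/andP: (h_itv _ (ps_policy s)) => h0 h1; rewrite ltr_wpDr// (le_trans h0).
have T4 : 4 <= (1 - disc M) * T%:R.
  rewrite mulrC -ler_pdivrMr//; have := Num.Theory.ceil_ge (4 / (1 - disc M)).
  by rewrite -T_def.
have uK : u K <= eps.
  have X_gt0 : 0 < (1 + hbar) / ((1 - disc M) * eps).
    by rewrite divr_gt0// mulr_gt0.
  have := Num.Theory.ceil_ge (ln ((1 + hbar) / ((1 - disc M) * eps)) / ln 2).
  rewrite -K_def ler_pdivrMr; last by rewrite ln_gt0// ltr1n.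
  rewrite -[_%:~R]/(K%:R) mulr_natl -lnXn// ler_ln ?posrE ?exprn_gt0//.
  rewrite ler_pdivrMr ?mulr_gt0// u_def ler_pdivrMr ?mulr_gt0 ?exprn_gt0//.
  by rewrite mulrA mulrC.
have bregman_le p : simplex A p -> bregman w dw (uniform A) p <= D0.
  move=> sp; apply: le_trans (D0_bound (fun=> p) (fun=> sp)).
  apply: le_trans (ler_norm _) _.
  exact: (ler_sup_norm (fun=> bregman w dw (uniform A) p) s).
have D0_ge0 : 0 <= D0.
  by apply: le_trans (D0_bound _ ps_policy); exact: bigmax_ge_id.
suff /andP[gap0 gapK] : 0 <= value M h (hatpi K) s - value M h pistar s <= u K.
  by rewrite ger0_norm// (le_trans gapK).
move: D0_ge0; rewrite le_eqVlt => /predU1P[D0_eq0|D0_gt0]; last first.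
  exact: (vmd_gap h_convex h_itv w_C1 w_strongly_convex pistar_optimal D0_gt0
    (fun s => bregman_le _ (ps_policy s)) T4 u_def eta_def run).
rewrite -D0_eq0 in bregman_le.
have uniq := simplex_singleton w_C1 w_strongly_convex N_norm bregman_le.
(* the simplex is a singleton: any step size yields the same run *)
have run1 : vmd_run M h w dw hbar K T (fun k _ => 2 ^+ k * 1 / u k)
    hatpi hatV pi V.
  case: (run) => *; split=> // k t s' kK tT.
  have [sz _] := vmd_policy_step run s' kK tT.
  by split=> // y /uniq ->; rewrite (uniq _ sz).
apply: (vmd_gap h_convex h_itv w_C1 w_strongly_convex pistar_optimal ltr01
  _ T4 u_def _ run1) => // s'.
exact: le_trans (bregman_le _ (ps_policy s')) ler01.
Qed.
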